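(* (1) For every game structure $G$ and all states $s,t$: $[s\preceq_1 t]=[t\preceq_2 s]$, and $[\simeq_1]=[\simeq_2]$. (2) There exist a game structure $G$ and states $s,t$ of $G$ with $[s\sqsubseteq_1 t]\ne[t\sqsubseteq_2 s]$. (3) There exist a game structure $G$ and states $s,t$ of $G$ with $[s\cong_1 t]\ne[s\cong_2 t]$.
   Context: A game structure $G=(S,[\cdot],\mathit{Moves},\Gamma_1,\Gamma_2,\delta)$: finite state set $S$; finite set $V$ of observation variables, each $v$ interpreted as $[v]:S\to[0,1]$; finite move set; $\Gamma_1,\Gamma_2:S\to2^{\mathit{Moves}}\setminus\{\emptyset\}$; $\delta:S\times\mathit{Moves}\times\mathit{Moves}\to\mathrm{Distr}(S)$. For player $i$, $\bar i=3-i$. Mixed moves $\mathcal{D}_i(s)=\mathrm{Distr}(\Gamma_i(s))$; $\delta(s,x_1,x_2)(u)=\sum_{a_1,a_2}\delta(s,a_1,a_2)(u)x_1(a_1)x_2(a_2)$, $x_j$ being player $j$'s mixed move. Valuations $k:S\to[0,1]$; $\mathrm{E}^{x_1,x_2}_s(k)=\sum_u\delta(s,x_1,x_2)(u)k(u)$; $\mathrm{Pre}_i(k)(s)=\sup_{x_i\in\mathcal{D}_i(s)}\inf_{x_{\bar i}\in\mathcal{D}_{\bar i}(s)}\mathrm{E}^{x_1,x_2}_s(k)$. Directed metrics: $d:S\times S\to\mathbb{R}_{\ge0}$, $d(s,s)=0$, triangle inequality; ordered pointwise; $\breve d(s,t)=d(t,s)$; $\sqcup=\max$. $C(d)=\{k:k(s)-k(t)\le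 d(s,t)\ \forall s,t\}$; $[s\equiv t]=\max_{v}|[v](s)-[v](t)|$. $H_{\preceq_i}(d)(s,t)=[s\equiv t]\sqcup\sup_{k\in C(d)}(\mathrm{Pre}_i(k)(s)-\mathrm{Pre}_i(k)(t))$; $H_{\sqsubseteq_i}(d)(s,t)=[s\equiv t]\sqcup\sup_{x_i\in\mathcal{D}_i(s)}\inf_{y_i\in\mathcal{D}_i(t)}\sup_{y_{\bar i}\in\mathcal{D}_{\bar i}(t)}\inf_{x_{\bar i}\in\mathcal{D}_{\bar i}(s)}\sup_{k\in C(d)}(\mathrm{E}^{x_1,x_2}_s(k)-\mathrm{E}^{y_1,y_2}_t(k))$. $[\preceq_i]$ = least fixpoint of $H_{\preceq_i}$ (a priori simulation metric), $[\simeq_i]$ = least symmetrical fixpoint of $H_{\preceq_i}$, i.e. least fixpoint of $d\mapsto H_{\preceq_i}(d)\sqcup\breve{H_{\preceq_i}(d)}$ (a priori bisimulation metric); $[\sqsubseteq_i]$ and $[\cong_i]$ are defined likewise from $H_{\sqsubseteq_i}$ (a posteriori metrics). Fixpoints are in the lattice of directed metrics. $[s\preceq_i t]$ denotes $[\preceq_i](s,t)$, etc. *)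

(* Defs.v *)
From mathcomp Require Import all_boot all_order all_algebra.
From mathcomp Require Import all_classical reals.
From mathcomp Require Import ring lra.

Set Implicit Arguments.
Unset Strict Implicit.
Unset Printing Implicit Defensive.

Import Order.TTheory GRing.Theory Num.Theory.

Local Open Scope classical_set_scope.
Local Open Scope ring_scope.

Definition is_distr (R : realType) (T : finType) (p : T -> R) : Prop :=
  (forall a, 0 <= p a) /\ \sum_(a : T) p a = 1.

Inductive player := P1 | P2.

Definition opponent (i : player) : player :=
  match i with P1 => P2 | P2 => P1 end.

Record game_structure (R : realType) := GameStructure {
  state : finType;
  obs : finType;
  interp : obs -> state -> R;
  interp_itv : forall v s, 0 <= interp v s <= 1;
  move : finType;
  Gam : player -> state -> {set move};
  Gam_neq0 : forall i s, Gam i s != finset.set0;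
  delta : state -> move -> move -> state -> R;
  delta_distr : forall s a1 a2, is_distr (delta s a1 a2)
}.

Section Game.
Context {R : realType} (G : game_structure R).

Local Notation S := (state G).
Local Notation M := (move G).

(* Distr(Gam i s), as distributions over all moves vanishing outside Gam i s *)
Definition mixed (i : player) (s : S) : set (M -> R) :=
  [set x | is_distr x /\ forall a, a \notin Gam i s -> x a = 0].

Definition delta_mixed (s : S) (x1 x2 : M -> R) (u : S) : R :=
  \sum_(a1 : M) \sum_(a2 : M) delta s a1 a2 u * x1 a1 * x2 a2.

Definition expect (s : S) (x1 x2 : M -> R) (k : S -> R) : R :=
  \sum_(u : S) delta_mixed s x1 x2 u * k u.

(* E_s^{x_1,x_2}(k), with x the mixed move of player i and xo the opponent's *)
Definition expect_for (i : player) (s : S) (x xo : M -> R) (k : S -> R) : R :=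
  match i with P1 => expect s x xo k | P2 => expect s xo x k end.

Definition Pre (i : player) (k : S -> R) (s : S) : R :=
  sup [set inf [set expect_for i s x xo k | xo in mixed (opponent i) s]
      | x in mixed i s].

Definition valuation (k : S -> R) : Prop := forall s, 0 <= k s <= 1.

Definition directed_metric (d : S -> S -> R) : Prop :=
  [/\ forall s t, 0 <= d s t,
      forall s, d s s = 0
    & forall s t u, d s u <= d s t + d t u].

Definition dle (d d' : S -> S -> R) : Prop := forall s t, d s t <= d' s t.

Definition dconv (d : S -> S -> R) : S -> S -> R := fun s t => d t s.

Definition djoin (d d' : S -> S -> R) : S -> S -> R :=
  fun s t => Num.max (d s t) (d' s t).

Definition Cval (d : S -> S -> R) : set (S -> R) :=
  [set k | valuation k /\ forall s t, k s - k t <= d s t].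

Definition obs_dist (s t : S) : R :=
  \big[Num.max/0]_(v : obs G) `|interp v s - interp v t|.

Definition H_prio (i : player) (d : S -> S -> R) : S -> S -> R := fun s t =>
  Num.max (obs_dist s t) (sup [set Pre i k s - Pre i k t | k in Cval d]).

Definition H_post (i : player) (d : S -> S -> R) : S -> S -> R := fun s t =>
  Num.max (obs_dist s t)
    (sup [set inf [set sup [set inf [set
       sup [set expect_for i s x xo k - expect_for i t y yo k | k in Cval d]
     | xo in mixed (opponent i) s]
     | yo in mixed (opponent i) t]
     | y in mixed i t]
     | x in mixed i s]).

Definition symmetrize (F : (S -> S -> R) -> (S -> S -> R)) :
    (S -> S -> R) -> (S -> S -> R) :=
  fun d => djoin (F d) (dconv (F d)).

Definition is_lfp (F : (S -> S -> R) -> (S -> S -> R)) (d : S -> S -> R) : Prop :=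
  [/\ directed_metric d, F d = d
    & forall d', directed_metric d' -> F d' = d' -> dle d d'].

(* The default value of [xget] is never used for the four operators below:
   see [is_lfp_sim_prio], ..., [is_lfp_bisim_post]. *)
Definition lfp (F : (S -> S -> R) -> (S -> S -> R)) : S -> S -> R :=
  xget (fun _ _ => 0) [set d | is_lfp F d].

Definition sim_prio (i : player) : S -> S -> R := lfp (H_prio i).

Definition bisim_prio (i : player) : S -> S -> R := lfp (symmetrize (H_prio i)).

Definition sim_post (i : player) : S -> S -> R := lfp (H_post i).

Definition bisim_post (i : player) : S -> S -> R := lfp (symmetrize (H_post i)).

End Game.

Section SupInf.
Context {R : realType} {T : Type}.
Implicit Types (A : set T) (f g : T -> R).

Definition bnd1 A f := forall a, A a -> -1 <= f a <= 1.

Lemma img_le_sup A f a : bnd1 A f -> A a -> f a <= sup [set f a | a in A].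
Proof.
move=> b Aa; apply: ub_le_sup; last by exists a.
by exists 1 => _ [c Ac <-]; have /andP[] := b _ Ac.
Qed.

Lemma inf_le_img A f a : bnd1 A f -> A a -> inf [set f a | a in A] <= f a.
Proof.
move=> b Aa; apply: ge_inf; last by exists a.
by exists (-1) => _ [c Ac <-]; have /andP[] := b _ Ac.
Qed.

Lemma sup_img_le A f c :
  A !=set0 -> (forall a, A a -> f a <= c) -> sup [set f a | a in A] <= c.
Proof.
move=> [a Aa] h; apply: ge_sup; first by exists (f a), a.
by move=> _ [e Ae <-]; exact: h.
Qed.

Lemma inf_img_adherent A f e : A !=set0 -> bnd1 A f -> 0 < e ->
  exists2 a, A a & f a < inf [set f a | a in A] + e.
Proof.
move=> [a Aa] b e0.
have [|_ [c Ac <-] h] := @inf_adherent _ [set f a | a in A] e e0.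
  split; first by exists (f a), a.
  by exists (-1) => _ [c Ac <-]; have /andP[] := b _ Ac.
by exists c.
Qed.

Lemma bnd1_sup A f : A !=set0 -> bnd1 A f -> -1 <= sup [set f a | a in A] <= 1.
Proof.
move=> [a Aa] b; apply/andP; split.
  by apply: le_trans (img_le_sup b Aa); have /andP[] := b _ Aa.
by apply: sup_img_le => [|c Ac]; [exists a|have /andP[] := b _ Ac].
Qed.

Lemma bnd1_inf A f : A !=set0 -> bnd1 A f -> -1 <= inf [set f a | a in A] <= 1.
Proof.
move=> [a Aa] b; apply/andP; split; last first.
  by apply: le_trans (inf_le_img b Aa) _; have /andP[] := b _ Aa.
apply: lb_le_inf => [|_ [c Ac <-]]; first by exists (f a), a.
by have /andP[] := b _ Ac.
Qed.

Lemma le_sup_img A B f g : A !=set0 -> A `<=` B -> bnd1 B g ->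
  (forall a, A a -> f a <= g a) ->
  sup [set f a | a in A] <= sup [set g a | a in B].
Proof.
move=> A0 AB b h; apply: sup_img_le => // a Aa.
exact: le_trans (h _ Aa) (img_le_sup b (AB _ Aa)).
Qed.

Lemma le_inf_img A f g : A !=set0 -> bnd1 A f ->
  (forall a, A a -> f a <= g a) ->
  inf [set f a | a in A] <= inf [set g a | a in A].
Proof.
move=> [a Aa] b h; apply: lb_le_inf => [|_ [c Ac <-]]; first by exists (g a), a.
exact: le_trans (inf_le_img b Ac) (h _ Ac).
Qed.

End SupInf.

Lemma eps4_chain (R : realType) (l4 l4' l3 l3' l2 l2' l1 l1' k k' a b c e : R) :
  l3 <= l4 -> l3' <= l4' -> l2 < l3 + e / 4 -> l2' < l3' + e / 4 ->
  l1' <= l2' -> l1 <= l2 -> k' < l1' + e / 4 -> k < l1 + e / 4 ->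
  a - b <= k -> b - c <= k' -> a - c <= l4 + l4' + e.
Proof. lra. Qed.

Section Existence.
Context {R : realType} (G : game_structure R).

Local Notation S := (state G).
Local Notation M := (move G).
Implicit Types (d : S -> S -> R) (k : S -> R) (i : player).

Lemma mixed_neq0 i (s : S) : mixed i s !=set0.
Proof.
have /set0Pn[a0 a0P] := Gam_neq0 i s.
exists (fun a => (a == a0)%:R); split; first split=> [a|].
- exact: ler0n.
- by rewrite (bigD1 a0)//= eqxx big1 ?addr0 // => a /negbTE ->.
- by move=> a aN; case: eqP => // aE; rewrite aE a0P in aN.
Qed.

Lemma delta_mixed_distr i j (s : S) (x1 x2 : M -> R) :
  mixed i s x1 -> mixed j s x2 -> is_distr (delta_mixed s x1 x2).
Proof.
move=> [[x1p x1s] _] [[x2p x2s] _]; split=> [u|].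
  rewrite /delta_mixed; apply: sumr_ge0 => a _; apply: sumr_ge0 => b _.
  by rewrite !mulr_ge0 //; have [] := delta_distr s a b.
rewrite /delta_mixed exchange_big /= -x1s; apply: eq_bigr => a _.
rewrite exchange_big /= -[RHS]mulr1 -x2s mulr_sumr; apply: eq_bigr => b _.
by rewrite -!mulr_suml (delta_distr s a b).2 mul1r.
Qed.

Lemma expect_for_itv i (s : S) (x xo : M -> R) k :
  mixed i s x -> mixed (opponent i) s xo -> valuation k ->
  0 <= expect_for i s x xo k <= 1.
Proof.
suff h p : is_distr p -> valuation k -> 0 <= \sum_(u : S) p u * k u <= 1.
  by move=> mx mxo vk; case: i mx mxo => mx mxo; apply: h => //;
     apply: delta_mixed_distr; eassumption.
move=> [p0 p1] vk; apply/andP; split.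
  by apply: sumr_ge0 => u _; rewrite mulr_ge0 //; have /andP[] := vk u.
rewrite -p1; apply: ler_sum => u _; apply: ler_piMr => //.
by have /andP[] := vk u.
Qed.

Lemma Pre_itv i k (s : S) : valuation k -> 0 <= Pre i k s <= 1.
Proof.
move=> vk; have b x : mixed i s x ->
    bnd1 (mixed (opponent i) s) (fun xo => expect_for i s x xo k).
  by move=> mx xo mxo; have := expect_for_itv mx mxo vk; lra.
have b' : bnd1 (mixed i s)
    (fun x => inf [set expect_for i s x xo k | xo in mixed (opponent i) s]).
  by move=> x mx; exact: bnd1_inf (mixed_neq0 _ _) (b _ mx).
have /andP[_ h1] := bnd1_sup (mixed_neq0 i s) b'.
rewrite /Pre h1 andbT.
have [x mx] := mixed_neq0 i s; apply: le_trans (img_le_sup b' mx).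
have [xo mxo] := mixed_neq0 (opponent i) s.
apply: lb_le_inf => [|_ [yo myo <-]]; first by eexists; exists xo.
by have /andP[] := expect_for_itv mx myo vk.
Qed.

Lemma Cval_const d : directed_metric d -> Cval d (fun=> 0).
Proof. by move=> [d0 _ _]; split=> [s|s t]; rewrite ?subrr // lexx ler01. Qed.

Lemma Cval_neq0 d : directed_metric d -> Cval d !=set0.
Proof. by move=> /Cval_const; exists (fun=> 0). Qed.

Lemma le_Cval d d' : dle d d' -> Cval d `<=` Cval d'.
Proof. by move=> dd' k [vk kd]; split=> // s t; exact: le_trans (dd' s t). Qed.

Lemma obs_dist_ge0 (s t : S) : 0 <= obs_dist s t.
Proof. exact: bigmax_ge_id. Qed.

Lemma obs_dist_le1 (s t : S) : obs_dist s t <= 1.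
Proof.
apply: bigmax_le => // v _; rewrite ler_norml.
by have := interp_itv v s; have := interp_itv v t; lra.
Qed.

Lemma obs_dist_refl (s : S) : obs_dist s s = 0.
Proof.
apply/le_anti; rewrite obs_dist_ge0 andbT.
by apply: bigmax_le => // v _; rewrite subrr normr0.
Qed.

Lemma obs_dist_triangle (s t u : S) :
  obs_dist s u <= obs_dist s t + obs_dist t u.
Proof.
apply: bigmax_le => [|v _]; first by rewrite addr_ge0 ?obs_dist_ge0.
apply: le_trans (ler_distD (interp v t) _ _) _.
by apply: lerD; apply: (le_bigmax _ (fun v => `|interp v _ - interp v _|)).
Qed.

Lemma directed_metric_join_obs (f : S -> S -> R) :
  (forall s, f s s <= 0) -> (forall s t u, f s u <= f s t + f t u) ->
  directed_metric (fun s t => Num.max (obs_dist s t) (f s t)).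
Proof.
move=> f0 ft; split=> [s t|s|s t u].
- by rewrite le_max obs_dist_ge0.
- by rewrite obs_dist_refl; apply/max_idPl.
- rewrite ge_max; apply/andP; split.
    apply: le_trans (obs_dist_triangle s t u) _.
    by apply: lerD; rewrite le_max lexx.
  by apply: le_trans (ft s t u) _; apply: lerD; rewrite le_max lexx orbT.
Qed.

Definition admissible (F : (S -> S -> R) -> (S -> S -> R)) : Prop :=
  [/\ forall d, directed_metric d -> directed_metric (F d),
      forall d, directed_metric d -> forall s t, F d s t <= 1
    & forall d d', directed_metric d -> directed_metric d' ->
        dle d d' -> dle (F d) (F d')].

Lemma admissible_symmetrize F : admissible F -> admissible (symmetrize F).
Proof.
move=> [Fd F1 Fm]; split=> [d dd|d dd s t|d d' dd dd' le s t].
- have [h0 hr ht] := Fd _ dd; split=> [s t|s|s t u];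
    rewrite /symmetrize /djoin /dconv.
  + by rewrite le_max h0.
  + by rewrite !hr maxxx.
  + rewrite ge_max; apply/andP; split.
      by apply: le_trans (ht s t u) _; apply: lerD; rewrite le_max lexx.
    apply: le_trans (ht u t s) _; rewrite addrC.
    by apply: lerD; rewrite le_max lexx orbT.
- by rewrite /symmetrize /djoin /dconv ge_max !F1.
- by rewrite /symmetrize /djoin /dconv ge_max !le_max !Fm ?orbT.
Qed.

Lemma bnd1_Pre d i (s t : S) :
  bnd1 (Cval d) (fun k => Pre i k s - Pre i k t).
Proof.
by move=> k [vk _]; have := Pre_itv i s vk; have := Pre_itv i t vk; lra.
Qed.

Lemma admissible_H_prio i : admissible (@H_prio R G i).
Proof.
split=> [d dd|d dd s t|d d' dd dd' le s t].
- apply: directed_metric_join_obs => [s|s t u].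
    by apply: sup_img_le => [|k _]; [exact: Cval_neq0|rewrite subrr].
  apply: sup_img_le => [|k kd]; first exact: Cval_neq0.
  have h1 := img_le_sup (bnd1_Pre (d := d) i s t) kd.
  have h2 := img_le_sup (bnd1_Pre (d := d) i t u) kd.
  by rewrite /= in h1 h2; lra.
- rewrite /H_prio ge_max obs_dist_le1 /=.
  by have /andP[] := bnd1_sup (Cval_neq0 dd) (bnd1_Pre (d := d) i s t).
- rewrite /H_prio ge_max !le_max lexx /=; apply/orP; right.
  apply: le_sup_img => //; [exact: Cval_neq0|exact: le_Cval|exact: bnd1_Pre].
Qed.

Section Post.
Context (i : player).

Let K d s t x y yo xo :=
  sup [set expect_for i s x xo k - expect_for i t y yo k | k in Cval d].
Let L1 d s t x y yo := inf [set K d s t x y yo xo | xo in mixed (opponent i) s].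
Let L2 d s t x y := sup [set L1 d s t x y yo | yo in mixed (opponent i) t].
Let L3 d s t x := inf [set L2 d s t x y | y in mixed i t].
Let L4 d s t := sup [set L3 d s t x | x in mixed i s].

Let bE d s t x y yo xo : mixed i s x -> mixed i t y ->
  mixed (opponent i) t yo -> mixed (opponent i) s xo ->
  bnd1 (Cval d) (fun k => expect_for i s x xo k - expect_for i t y yo k).
Proof.
move=> mx my myo mxo k [vk _].
by have := expect_for_itv mx mxo vk; have := expect_for_itv my myo vk; lra.
Qed.

Let bK d s t x y yo : directed_metric d -> mixed i s x -> mixed i t y ->
  mixed (opponent i) t yo -> bnd1 (mixed (opponent i) s) (K d s t x y yo).
Proof.
by move=> dd mx my myo xo mxo; exact: bnd1_sup (Cval_neq0 dd) (bE mx my myo mxo).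
Qed.

Let b1 d s t x y : directed_metric d -> mixed i s x -> mixed i t y ->
  bnd1 (mixed (opponent i) t) (L1 d s t x y).
Proof.
by move=> dd mx my yo myo; exact: bnd1_inf (mixed_neq0 _ _) (bK dd mx my myo).
Qed.

Let b2 d s t x : directed_metric d -> mixed i s x ->
  bnd1 (mixed i t) (L2 d s t x).
Proof.
by move=> dd mx y my; exact: bnd1_sup (mixed_neq0 _ _) (b1 dd mx my).
Qed.

Let b3 d s t : directed_metric d -> bnd1 (mixed i s) (L3 d s t).
Proof. by move=> dd x mx; exact: bnd1_inf (mixed_neq0 _ _) (b2 dd mx). Qed.

Let L4_refl d s : directed_metric d -> L4 d s s <= 0.
Proof.
move=> dd; apply: sup_img_le => [|x mx]; first exact: mixed_neq0.
apply: le_trans (inf_le_img (b2 dd mx) mx) _.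
apply: sup_img_le => [|yo myo]; first exact: mixed_neq0.
apply: le_trans (inf_le_img (bK dd mx mx myo) myo) _.
by apply: sup_img_le => [|k _]; [exact: Cval_neq0|rewrite subrr].
Qed.

Let L4_triangle d s t u : directed_metric d ->
  L4 d s u <= L4 d s t + L4 d t u.
Proof.
move=> dd; apply/ler_addgt0Pr => e e0.
have e4 : 0 < e / 4 by lra.
apply: sup_img_le => [|x mx]; first exact: mixed_neq0.
have [y my hy] := inf_img_adherent (mixed_neq0 i t) (b2 dd mx) e4.
have [z mz hz] := inf_img_adherent (mixed_neq0 i u) (b2 dd my) e4.
have h1 : L3 d s t x <= L4 d s t := img_le_sup (b3 _ dd) mx.
have h2 : L3 d t u y <= L4 d t u := img_le_sup (b3 _ dd) my.
have h3 : L2 d s t x y < L3 d s t x + e / 4 := hy.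
have h4 : L2 d t u y z < L3 d t u y + e / 4 := hz.
apply: le_trans (inf_le_img (b2 dd mx) mz) _.
apply: sup_img_le => [|zo mzo]; first exact: mixed_neq0.
have [yo myo hyo] := inf_img_adherent (mixed_neq0 _ _) (bK dd my mz mzo) e4.
have [xo mxo hxo] := inf_img_adherent (mixed_neq0 _ _) (bK dd mx my myo) e4.
have h5 : L1 d t u y z zo <= L2 d t u y z := img_le_sup (b1 dd my mz) mzo.
have h6 : L1 d s t x y yo <= L2 d s t x y := img_le_sup (b1 dd mx my) myo.
have h7 : K d t u y z zo yo < L1 d t u y z zo + e / 4 := hyo.
have h8 : K d s t x y yo xo < L1 d s t x y yo + e / 4 := hxo.
apply: le_trans (inf_le_img (bK dd mx mz mzo) mxo) _.
apply: sup_img_le => [|k kd]; first exact: Cval_neq0.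
have h9 : _ <= K d s t x y yo xo := img_le_sup (bE mx my myo mxo) kd.
have h10 : _ <= K d t u y z zo yo := img_le_sup (bE my mz mzo myo) kd.
exact: eps4_chain h1 h2 h3 h4 h5 h6 h7 h8 h9 h10.
Qed.

Lemma admissible_H_post : admissible (@H_post R G i).
Proof.
split=> [d dd|d dd s t|d d' dd dd' le s t].
- by apply: directed_metric_join_obs => [s|s t u];
    [exact: L4_refl|exact: L4_triangle].
- rewrite /H_post ge_max obs_dist_le1 /=.
  by have /andP[] := bnd1_sup (mixed_neq0 i s) (@b3 d s t dd).
- rewrite /H_post ge_max !le_max lexx /=; apply/orP; right.
  apply: le_sup_img => [||| x mx] //; [exact: mixed_neq0|exact: b3|].
  apply: le_inf_img => [||y my]; [exact: mixed_neq0|exact: b2|].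
  apply: le_sup_img => [||| yo myo] //; [exact: mixed_neq0|exact: b1|].
  apply: le_inf_img => [||xo mxo]; [exact: mixed_neq0|exact: bK|].
  by apply: le_sup_img => //; [exact: Cval_neq0|exact: le_Cval|exact: bE].
Qed.

End Post.

Lemma admissible_is_lfp F : admissible F -> is_lfp F (lfp F).
Proof.
move=> [Fd F1 Fm]; rewrite /lfp; apply: (@xgetPex _ _ [set d | is_lfp F d]).
pose top : S -> S -> R := fun s t => (s != t)%:R.
have dtop : directed_metric top.
  split=> [s t|s|s t u]; rewrite /top ?ler0n ?eqxx //.
  have [<-|st] := eqVneq s t; first by rewrite add0r.
  by case: (s != u) (t != u) => [] [] /=; lra.
have Ftop d : directed_metric d -> dle (F d) top.
  move=> dd s t; rewrite /top; have [<-|_] := eqVneq s t; last exact: F1.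
  by have [_ -> _] := Fd _ dd.
pose P := [set d | directed_metric d /\ dle (F d) d].
pose L := [set d | directed_metric d /\ forall d', P d' -> dle d d'].
have Ptop : P top by split => //; exact: Ftop.
pose m : S -> S -> R := fun s t => sup [set d s t | d in L].
have bL s t : bnd1 L (fun d => d s t).
  move=> d [[d0 _ _] dP]; apply/andP; split; first by apply: le_trans (d0 _ _); lra.
  by apply: le_trans (dP _ Ptop s t) _; rewrite /top; case: (s != t).
have L0 : L (fun _ _ => 0).
  split; first by split=> *; rewrite ?addr0.
  by move=> d' [[d0 _ _] _] s t.
have Lne : L !=set0 by exists (fun _ _ => 0).
have Lm d : L d -> dle d m by move=> Ld s t; exact: (img_le_sup (bL s t) Ld).
have mP d : P d -> dle m d.
  by move=> Pd s t; apply: sup_img_le => // d' [_ h]; exact: h.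
have dm : directed_metric m.
  split=> [s t|s|s t u].
  - exact: (Lm _ L0).
  - apply/le_anti; rewrite (Lm _ L0 s s) andbT.
    by apply: sup_img_le => // d [[_ -> _] _].
  - apply: sup_img_le => // d Ld; have [[_ _ dt] _] := Ld.
    by apply: le_trans (dt s t u) _; apply: lerD; exact: Lm.
have LFm : L (F m).
  split=> [|d Pd s t]; first exact: Fd.
  have [dd Fdd] := Pd; apply: le_trans (Fdd s t).
  by apply: Fm => //; exact: mP.
have Fmm : dle (F m) m by exact: Lm.
exists m; split=> // [|d dd Fdd].
  apply/funext => s; apply/funext => t; apply/le_anti; rewrite Fmm /=.
  apply: mP; split; first exact: Fd.
  by apply: Fm => //; exact: Fd.
by apply: mP; split=> // s t; rewrite Fdd.
Qed.

Lemma is_lfp_sim_prio i : is_lfp (H_prio i) (@sim_prio R G i).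
Proof. exact: admissible_is_lfp (admissible_H_prio i). Qed.

Lemma is_lfp_bisim_prio i : is_lfp (symmetrize (H_prio i)) (@bisim_prio R G i).
Proof. exact: admissible_is_lfp (admissible_symmetrize (admissible_H_prio i)). Qed.

Lemma is_lfp_sim_post i : is_lfp (H_post i) (@sim_post R G i).
Proof. exact: admissible_is_lfp (admissible_H_post i). Qed.

Lemma is_lfp_bisim_post i : is_lfp (symmetrize (H_post i)) (@bisim_post R G i).
Proof. exact: admissible_is_lfp (admissible_symmetrize (admissible_H_post i)). Qed.

End Existence.

(* Main.v *)
Require Import Defs.
From mathcomp Require Import all_boot all_order all_algebra.
From mathcomp Require Import all_classical reals.
From mathcomp Require Import ring lra.

Set Implicit Arguments.
Unset Strict Implicit.
Unset Printing Implicit Defensive.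

Import Order.TTheory GRing.Theory Num.Theory.

Local Open Scope classical_set_scope.
Local Open Scope ring_scope.

(** The minimax theorem gives Pre_2(1 - k) = 1 - Pre_1(k), and k |-> 1 - k
    exchanges C(d) with the C of the converse of d; hence H_prio for player 2 is
    the converse of H_prio for player 1, and so are their least fixpoints.

    A posteriori, the opponent's move is chosen before the valuation k, so the
    objective |p - q| is not concave in it and the order of quantifiers matters.
    Let a fair coin s show heads with probability 1/2, and a steered coin t with
    probability (y1 + 2 y2) / 3. Whatever y1 is, player 2 can keep t at distance
    1/3 from s, so player 1's metrics from s to t are at least 1/3. But the
    answers y2 = 1/2 (simulating s by t) and y1 = 1 - y2 (simulating t by s)
    keep the distance within 1/6, so player 2's metrics are at most 1/6. *)

Section Complement.
Context {R : realType}.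
Implicit Types (E : set R) (c : R).

Lemma sup_compl E c : has_inf E -> sup [set c - a | a in E] = c - inf E.
Proof.
move=> [[a Ea] lbE]; have ne : [set c - a | a in E] !=set0 by exists (c - a), a.
have ub : ubound [set c - a | a in E] (c - inf E).
  by move=> _ [b Eb <-]; rewrite lerD2l lerN2 ge_inf.
apply/le_anti; rewrite ge_sup //= lerBlDr -lerBlDl.
apply: lb_le_inf => [|b Eb]; first by exists a.
by rewrite lerBlDl -lerBlDr ub_le_sup //; [exists (c - inf E)|exists b].
Qed.

Lemma inf_compl E c : has_sup E -> inf [set c - a | a in E] = c - sup E.
Proof.
move=> [[a Ea] [u Eu]]; rewrite -[inf _](subKr c) -sup_compl; last first.
  split; first by exists (c - a), a.
  by exists (c - u) => _ [b Eb <-]; rewrite lerD2l lerN2 Eu.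
rewrite image_comp; congr (c - sup _).
by apply: eq_image_id => b _ /=; exact: subKr.
Qed.

End Complement.

Definition sup_inf {R : realType} {T U : Type} (X : set T) (Y : set U)
    (f : T -> U -> R) : R :=
  sup [set inf [set f x y | y in Y] | x in X].

Definition inf_sup {R : realType} {T U : Type} (X : set T) (Y : set U)
    (f : T -> U -> R) : R :=
  inf [set sup [set f x y | x in X] | y in Y].

Section SupInf.
Context {R : realType} {T U : Type}.

Lemma eq_sup_inf (X : set T) (Y : set U) (f g : T -> U -> R) :
  (forall x y, X x -> Y y -> f x y = g x y) -> sup_inf X Y f = sup_inf X Y g.
Proof.
move=> fg; congr sup; apply: eq_imagel => x Xx.
by congr inf; apply: eq_imagel => y Yy; exact: fg.
Qed.

Variables (X : set T) (Y : set U) (f : T -> U -> R) (B : R).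
Hypotheses (X_neq0 : X !=set0) (Y_neq0 : Y !=set0).
Hypothesis f_bounded : forall x y, X x -> Y y -> `|f x y| <= B.

Let le_f x y : X x -> Y y -> - B <= f x y.
Proof.
by move=> Xx Yy; have := f_bounded Xx Yy; rewrite ler_norml => /andP[].
Qed.

Let f_le x y : X x -> Y y -> f x y <= B.
Proof.
by move=> Xx Yy; have := f_bounded Xx Yy; rewrite ler_norml => /andP[].
Qed.

Let has_inf_row x : X x -> has_inf [set f x y | y in Y].
Proof.
move=> Xx; have [y Yy] := Y_neq0; split; first by exists (f x y), y.
by exists (- B) => _ [z Yz <-]; exact: le_f.
Qed.

Let has_sup_column y : Y y -> has_sup [set f x y | x in X].
Proof.
move=> Yy; have [x Xx] := X_neq0; split; first by exists (f x y), x.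
by exists B => _ [z Xz <-]; exact: f_le.
Qed.

Let inf_row_le x y : X x -> Y y -> inf [set f x y | y in Y] <= f x y.
Proof. by move=> /has_inf_row[_ lb] Yy; apply: ge_inf => //; exists y. Qed.

Let le_sup_column x y : X x -> Y y -> f x y <= sup [set f x y | x in X].
Proof.
by move=> Xx /has_sup_column[_ ub]; apply: ub_le_sup => //; exists x.
Qed.

Let has_sup_infs : has_sup [set inf [set f x y | y in Y] | x in X].
Proof.
have [[x Xx] [y Yy]] := (X_neq0, Y_neq0); split; first by eexists; exists x.
by exists B => _ [z Xz <-]; exact: le_trans (inf_row_le Xz Yy) (f_le Xz Yy).
Qed.

Let has_inf_sups : has_inf [set sup [set f x y | x in X] | y in Y].
Proof.
have [[x Xx] [y Yy]] := (X_neq0, Y_neq0); split; first by eexists; exists y.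
exists (- B) => _ [z Yz <-].
exact: le_trans (le_f Xx Yz) (le_sup_column Xx Yz).
Qed.

Lemma le_sup_inf x c :
  X x -> (forall y, Y y -> c <= f x y) -> c <= sup_inf X Y f.
Proof.
move=> Xx cf; apply: (@le_trans _ _ (inf [set f x y | y in Y])).
  by apply: lb_le_inf => [|_ [y Yy <-]]; [case: (has_inf_row Xx)|exact: cf].
by apply: ub_le_sup; [case: has_sup_infs|exists x].
Qed.

Lemma sup_inf_le c :
  (forall x, X x -> exists2 y, Y y & f x y <= c) -> sup_inf X Y f <= c.
Proof.
move=> fc; apply: ge_sup => [|_ [x Xx <-]]; first by case: has_sup_infs.
by have [y Yy] := fc x Xx; apply: le_trans; exact: inf_row_le.
Qed.

Lemma inf_sup_le y c :
  Y y -> (forall x, X x -> f x y <= c) -> inf_sup X Y f <= c.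
Proof.
move=> Yy fc; apply: (@le_trans _ _ (sup [set f x y | x in X])).
  by apply: ge_inf; [case: has_inf_sups|exists y].
by apply: ge_sup => [|_ [x Xx <-]]; [case: (has_sup_column Yy)|exact: fc].
Qed.

Lemma sup_inf_le_inf_sup : sup_inf X Y f <= inf_sup X Y f.
Proof.
apply: lb_le_inf => [|_ [y Yy <-]]; first by case: has_inf_sups.
by apply: sup_inf_le => x Xx; exists y => //; exact: le_sup_column.
Qed.

Lemma norm_sup_inf_le : `|sup_inf X Y f| <= B.
Proof.
have [[x Xx] [y Yy]] := (X_neq0, Y_neq0); rewrite ler_norml.
apply/andP; split; first by apply: (le_sup_inf Xx) => z; exact: le_f.
by apply: sup_inf_le => z Xz; exists y => //; exact: f_le.
Qed.

Lemma sup_inf_compl c :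
  sup_inf Y X (fun y x => c - f x y) = c - inf_sup X Y f.
Proof.
rewrite -(sup_compl c has_inf_sups) image_comp; congr sup.
apply: eq_imagel => y Yy /=.
by rewrite -(inf_compl c (has_sup_column Yy)) image_comp.
Qed.

End SupInf.

Section Mean.
Context {R : realType} {T : finType}.
Implicit Types (p q f : T -> R) (P : {set T}).

Definition mean p f : R := \sum_a p a * f a.

Definition distr_on P : set (T -> R) :=
  [set p | is_distr p /\ forall a, a \notin P -> p a = 0].

Lemma mean_compl p f : is_distr p -> mean p (fun a => 1 - f a) = 1 - mean p f.
Proof.
by move=> [_ p1]; rewrite -[1 in RHS]p1 -sumrB; apply: eq_bigr => a _; ring.
Qed.

Lemma mean_conv p q f l :
  mean (fun a => l * p a + (1 - l) * q a) f =
  l * mean p f + (1 - l) * mean q f.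
Proof.
by rewrite /mean !mulr_sumr -big_split; apply: eq_bigr => a _ /=; ring.
Qed.

Lemma norm_mean_le p f B :
  is_distr p -> (forall a, `|f a| <= B) -> `|mean p f| <= B.
Proof.
move=> [p0 p1] fB; apply: le_trans (ler_norm_sum _ _ _) _.
rewrite -[leRHS]mul1r -p1 mulr_suml; apply: ler_sum => a _.
by rewrite normrM ger0_norm // ler_wpM2l.
Qed.

Lemma mean_le P p f c :
  distr_on P p -> (forall a, a \in P -> f a <= c) -> mean p f <= c.
Proof.
move=> [[p0 p1] pP] fc; rewrite -[leRHS]mul1r -p1 mulr_suml.
apply: ler_sum => a _.
by have [/fc fac|/pP ->] := boolP (a \in P); rewrite ?mul0r // ler_wpM2l.
Qed.

Lemma distr_on_conv P p q l : 0 <= l <= 1 -> distr_on P p -> distr_on P q ->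
  distr_on P (fun a => l * p a + (1 - l) * q a).
Proof.
move=> /andP[l0 l1] [[p0 p1] pP] [[q0 q1] qP]; split; first split=> [a|].
- by rewrite addr_ge0 // mulr_ge0 // subr_ge0.
- by rewrite big_split /= -!mulr_sumr p1 q1; ring.
- by move=> a aP; rewrite pP // qP // !mulr0 addr0.
Qed.

End Mean.

Definition convexlike {R : realType} {I V : Type} (Y : set V)
    (g : I -> V -> R) : Prop :=
  forall l y y', 0 <= l <= 1 -> Y y -> Y y' ->
  exists2 z, Y z & forall a, g a z <= l * g a y + (1 - l) * g a y'.

Section Minimax.
Context {R : realType} {I : finType} {V : Type}.
Implicit Types (x w : I -> R) (y z : V) (l c e : R).

Variables (P : {set I}) (Y : set V) (g : I -> V -> R) (B : R).
Hypotheses (Y_neq0 : Y !=set0) (g_convexlike : convexlike Y g).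
Hypothesis g_bounded : forall a y, Y y -> `|g a y| <= B.

Definition excess c y a : R := Num.max 0 (g a y - c).

Definition potential c y : R := \sum_(a in P) excess c y a ^+ 2.

Lemma excess_ge0 c y a : 0 <= excess c y a.
Proof. by rewrite le_max lexx. Qed.

Lemma excess_sqr_le c y a r : g a y - c <= r -> excess c y a ^+ 2 <= r ^+ 2.
Proof.
rewrite /excess; case: (leP 0 (g a y - c)) => [g0 gr|_ _].
  by rewrite ler_sqr // nnegrE // (le_trans g0).
by rewrite expr0n sqr_ge0.
Qed.

Lemma potential_ge0 c y : 0 <= potential c y.
Proof. by apply: sumr_ge0 => a _; exact: sqr_ge0. Qed.

Section Response.
Variable c : R.
Hypothesis response :
  forall x, distr_on P x -> exists2 y, Y y & mean x (g ^~ y) <= c.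

Lemma weighted_response w : (forall a, 0 <= w a) ->
  exists2 y, Y y & \sum_(a in P) w a * (g a y - c) <= 0.
Proof.
move=> w0; pose W := \sum_(a in P) w a.
have [W0|W_neq0] := eqVneq W 0.
  have [y Yy] := Y_neq0; exists y => //; rewrite big1 // => a aP.
  by rewrite (psumr_eq0P _ W0) ?mul0r.
have W_gt0 : 0 < W by rewrite lt_neqAle eq_sym W_neq0; exact: sumr_ge0.
pose x a := if a \in P then w a / W else 0.
have [|y Yy xyc] := response (x := x).
  split; first split=> [a|].
  - by rewrite /x; case: ifP => // _; rewrite divr_ge0 // ltW.
  - by rewrite -big_mkcond -mulr_suml divff.
  - by move=> a /negbTE aP; rewrite /x aP.
exists y => //; suff -> : \sum_(a in P) w a * (g a y - c) =
    W * (mean x (g ^~ y) - c) by rewrite pmulr_rle0 // subr_le0.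
have -> : mean x (g ^~ y) = \sum_(a in P) w a / W * g a y.
  rewrite [RHS]big_mkcond; apply: eq_bigr => a _.
  by rewrite /x; case: ifP => // _; rewrite mul0r.
rewrite mulrBr mulr_sumr mulr_suml -sumrB.
by apply: eq_bigr => a _; field.
Qed.

(* Blackwell's approachability: mixing into [y] a response to the current
   excess makes the cross term of the squared norm nonpositive. As the gain is
   of order l and the loss of order l^2, the infimum of the potential is 0. *)
Lemma potential_step l y : 0 <= l <= 1 -> Y y ->
  exists2 z, Y z & potential c z <=
    (1 - l) ^+ 2 * potential c y + l ^+ 2 * \sum_(a in P) (B + `|c|) ^+ 2.
Proof.
move=> l01 Yy; have l01' : 0 <= 1 - l <= 1 by lra.
have [y' Yy' cross] := weighted_response (excess_ge0 c y).
have [z Yz gz] := g_convexlike l01' Yy Yy'; exists z => //.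
apply: (@le_trans _ _ (\sum_(a in P) ((1 - l) ^+ 2 * excess c y a ^+ 2 +
    l ^+ 2 * (B + `|c|) ^+ 2 +
    2 * l * (1 - l) * (excess c y a * (g a y' - c))))); last first.
  rewrite !big_split /= -!mulr_sumr gerDl; apply: mulr_ge0_le0 => //.
  by rewrite !mulr_ge0 //; lra.
apply: ler_sum => a _.
apply: le_trans (excess_sqr_le (r := (1 - l) * excess c y a
    + l * (g a y' - c)) _) _.
  have gy : g a y - c <= excess c y a by rewrite le_max lexx orbT.
  by have := gz a; have := ler_wpM2l (proj1 (andP l01')) gy; lra.
have : (g a y' - c) ^+ 2 <= (B + `|c|) ^+ 2.
  rewrite -real_normK ?num_real // ler_sqr ?nnegrE ?addr_ge0 //.
    by apply: le_trans (ler_normB _ _) _; rewrite lerD2r g_bounded.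
  exact: le_trans (g_bounded a Yy').
by move=> /(ler_wpM2l (sqr_ge0 l)); lra.
Qed.

Lemma inf_potential_le0 : inf [set potential c y | y in Y] <= 0.
Proof.
set m := inf _; rewrite leNgt; apply/negP => m0.
set C := \sum_(a in P) (B + `|c|) ^+ 2.
have C0 : 0 <= C by apply: sumr_ge0 => a _; exact: sqr_ge0.
have has_inf_potential : has_inf [set potential c y | y in Y].
  have [y Yy] := Y_neq0; split; first by exists (potential c y), y.
  by exists 0 => _ [y' _ <-]; exact: potential_ge0.
(* This [l] minimizes (1 - l)^2 m + l^2 C. *)
have [l [l0 l1 lE]] : exists l, [/\ 0 < l, l <= 1 & l * (m + C) = m].
  exists (m / (m + C)); split; last by rewrite divfK // gt_eqF // ltr_wpDr.
    by rewrite divr_gt0 // ltr_wpDr.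
  by rewrite ler_pdivrMr ?ltr_wpDr // mul1r lerDl.
have [_ [y Yy <-]] := inf_adherent (mulr_gt0 l0 m0) has_inf_potential.
rewrite -/m => /ltW/(ler_wpM2l (sqr_ge0 (1 - l))) ym.
have [|z Yz z_step] := potential_step (l := l) _ Yy; first by rewrite ltW.
have mz : m <= potential c z.
  by apply: ge_inf; [case: has_inf_potential|exists z].
have lC : l ^+ 2 * C = l * (l * (m + C)) - l ^+ 2 * m by ring.
have : 0 < l ^+ 2 * (2 - l) * m by rewrite !mulr_gt0 ?exprn_gt0 //; lra.
by move: z_step; rewrite -/C lC lE; lra.
Qed.

Lemma uniform_response e : 0 < e ->
  exists2 y, Y y & forall a, a \in P -> g a y <= c + e.
Proof.
move=> e0; have e20 : 0 < e ^+ 2 by rewrite exprn_gt0.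
have [y0 Yy0] := Y_neq0.
have [||_ [y Yy <-] ye] := @inf_lt _ [set potential c y | y in Y] (e ^+ 2).
- by exists (potential c y0), y0.
- exact: le_lt_trans inf_potential_le0 e20.
exists y => // a aP; rewrite leNgt; apply/negP => ga.
suff : e ^+ 2 <= potential c y by rewrite leNgt ye.
rewrite /potential (bigD1 a) //=; apply: ler_wpDr.
  by apply: sumr_ge0 => b _; exact: sqr_ge0.
rewrite ler_sqr ?nnegrE ?excess_ge0 ?ltW //.
by rewrite lt_max; apply/orP; right; lra.
Qed.

End Response.

Lemma minimax : distr_on (R := R) P !=set0 ->
  sup_inf (distr_on P) Y (fun x y => mean x (g ^~ y)) =
  inf_sup (distr_on P) Y (fun x y => mean x (g ^~ y)).
Proof.
move=> P_neq0.
have mean_bounded x y : distr_on P x -> Y y -> `|mean x (g ^~ y)| <= B.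
  by move=> [dx _] Yy; apply: norm_mean_le => // a; exact: g_bounded.
apply/le_anti; rewrite (sup_inf_le_inf_sup P_neq0 Y_neq0 mean_bounded) /=.
apply/ler_addgt0Pr => e e0; set v := sup_inf _ _ _.
have response x :
    distr_on P x -> exists2 y, Y y & mean x (g ^~ y) <= v + e / 2.
  move=> Px; apply: contrapT => no_response.
  suff : v + e / 2 <= v by lra.
  apply: (le_sup_inf P_neq0 Y_neq0 mean_bounded Px) => y Yy.
  by rewrite leNgt; apply/negP => /ltW gv; apply: no_response; exists y.
have [|y Yy gy] := uniform_response response (e := e / 2); first lra.
apply: (inf_sup_le P_neq0 Y_neq0 mean_bounded Yy) => x Px.
by apply: (mean_le Px) => a /gy; lra.
Qed.

End Minimax.

Lemma opponentK : involutive opponent.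
Proof. by case. Qed.

Section Players.
Context {R : realType} (G : game_structure R).
Implicit Types (i : player) (s : state G) (k : state G -> R).

Definition move_value i s k (a b : move G) : R :=
  mean (match i with P1 => delta s a b | P2 => delta s b a end) k.

Lemma expect_forE i s x xo k :
  expect_for i s x xo k = mean x (fun a => mean xo (move_value i s k a)).
Proof.
have expectE x1 x2 : expect s x1 x2 k =
    \sum_a \sum_b \sum_u delta s a b u * x1 a * x2 b * k u.
  rewrite /expect /delta_mixed; under eq_bigr do rewrite mulr_suml.
  rewrite exchange_big; apply: eq_bigr => a _ /=.
  by under eq_bigr do rewrite mulr_suml; rewrite exchange_big.
case: i; rewrite /= expectE; last rewrite exchange_big.
all: apply: eq_bigr => a _; rewrite /mean mulr_sumr; apply: eq_bigr => b _.
all: by rewrite !mulr_sumr; apply: eq_bigr => u _; ring.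
Qed.

Lemma norm_move_value_le1 i s k a b :
  valuation k -> `|move_value i s k a b| <= 1.
Proof.
move=> vk; apply: norm_mean_le => [|u]; first by case: i; exact: delta_distr.
by have /andP[k0 k1] := vk u; rewrite ger0_norm.
Qed.

Lemma expect_for_opponent i s x xo k :
  expect_for (opponent i) s xo x k = expect_for i s x xo k.
Proof. by case: i. Qed.

Lemma expect_for_compl i s x xo k :
  mixed i s x -> mixed (opponent i) s xo ->
  expect_for i s x xo (fun u => 1 - k u) = 1 - expect_for i s x xo k.
Proof.
by case: i => mx mxo; apply: mean_compl;
  [exact: delta_mixed_distr mx mxo|exact: delta_mixed_distr mxo mx].
Qed.

Lemma Pre_minimax i s k : valuation k ->
  Pre i k s = inf_sup (mixed i s) (mixed (opponent i) s)
                (fun x xo => expect_for i s x xo k).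
Proof.
move=> vk; have payoffE : (fun x xo => expect_for i s x xo k) =
    (fun x xo => mean x (fun a => mean xo (move_value i s k a))).
  by apply/funext => x; apply/funext => xo; exact: expect_forE.
rewrite /Pre -/(sup_inf _ _ _) payoffE.
apply: (@minimax _ _ _ (Gam i s) _
  (fun a xo => mean xo (move_value i s k a)) 1).
- exact: mixed_neq0.
- move=> l y y' l01 my my'; exists (fun b => l * y b + (1 - l) * y' b).
    exact: distr_on_conv.
  by move=> a; rewrite mean_conv.
- move=> a xo [dxo _]; apply: norm_mean_le => // b.
  exact: norm_move_value_le1.
- exact: mixed_neq0.
Qed.

Lemma valuation_compl k : valuation k -> valuation (fun u => 1 - k u).
Proof. by move=> vk u; have := vk u; lra. Qed.

Lemma Pre_compl i s k :
  valuation k -> Pre (opponent i) (fun u => 1 - k u) s = 1 - Pre i k s.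
Proof.
move=> vk; have bounded x xo : mixed i s x -> mixed (opponent i) s xo ->
    `|expect_for i s x xo k| <= 1.
  by move=> mx mxo; rewrite ger0_norm; have /andP[] := expect_for_itv mx mxo vk.
rewrite (Pre_minimax i s vk).
rewrite -(sup_inf_compl (mixed_neq0 _ _) (mixed_neq0 _ _) bounded).
rewrite /Pre opponentK; apply: eq_sup_inf => xo x mxo mx.
by rewrite expect_for_opponent expect_for_compl.
Qed.

End Players.

Section Converse.
Context {R : realType} {G : game_structure R}.
Implicit Types (d : state G -> state G -> R) (i : player).

Lemma dconvK d : dconv (dconv d) = d.
Proof. by []. Qed.

Lemma obs_distC (s t : state G) : obs_dist s t = obs_dist t s.
Proof. by apply: eq_bigr => v _; rewrite distrC. Qed.

Lemma directed_metric_dconv d : directed_metric d -> directed_metric (dconv d).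
Proof.
by move=> [d0 dr dt]; rewrite /dconv; split=> // s t u; rewrite addrC.
Qed.

Lemma dconv_symmetrize (F : (state G -> state G -> R) -> _) d :
  dconv (symmetrize F d) = symmetrize F d.
Proof. by apply/funext => s; apply/funext => t; exact: maxC. Qed.

Lemma symmetrize_dconv (F F' : (state G -> state G -> R) -> _) :
  (forall d, F' (dconv d) = dconv (F d)) ->
  forall d, symmetrize F' (dconv d) = dconv (symmetrize F d).
Proof. by move=> FF' d; rewrite /symmetrize FF'. Qed.

Lemma Cval_compl d k : Cval d k -> Cval (dconv d) (fun u => 1 - k u).
Proof.
move=> [vk kd]; split=> [|s t]; first exact: valuation_compl.
by rewrite /dconv; have := kd t s; lra.
Qed.

Lemma H_prio_dconv i d : H_prio (opponent i) (dconv d) = dconv (H_prio i d).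
Proof.
have complK (k : state G -> R) : (fun u => 1 - (1 - k u)) = k.
  by apply/funext => u; exact: subKr.
apply/funext => t; apply/funext => s; rewrite /dconv /H_prio obs_distC.
congr (Num.max _ (sup _)); apply/seteqP; split=> _ [k kd <-];
  exists (fun u => 1 - k u); try exact: Cval_compl.
- have := Pre_compl i t (valuation_compl kd.1).
  have := Pre_compl i s (valuation_compl kd.1).
  by rewrite complK => -> ->; ring.
- by rewrite !Pre_compl; [ring|exact: kd.1..].
Qed.

Lemma is_lfp_dconv (F F' : (state G -> state G -> R) -> _) d d' :
  (forall e, F' (dconv e) = dconv (F e)) ->
  is_lfp F d -> is_lfp F' d' -> d' = dconv d.
Proof.
move=> FF' [dd Fd d_min] [dd' Fd' d'_min].
apply/funext => s; apply/funext => t; apply/le_anti/andP; split.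
  by apply: d'_min; [exact: directed_metric_dconv|rewrite FF' Fd].
apply: (d_min (dconv d')); first exact: directed_metric_dconv.
by rewrite -[LHS]dconvK -FF' dconvK Fd'.
Qed.

Lemma sim_prio_opponent i : sim_prio (opponent i) = dconv (@sim_prio R G i).
Proof.
exact: is_lfp_dconv (H_prio_dconv i) (is_lfp_sim_prio G i)
  (is_lfp_sim_prio G (opponent i)).
Qed.

Lemma bisim_prio_opponent i : bisim_prio (opponent i) = @bisim_prio R G i.
Proof.
rewrite (is_lfp_dconv (symmetrize_dconv (H_prio_dconv i))
  (is_lfp_bisim_prio G i) (is_lfp_bisim_prio G (opponent i))).
by have [_ <- _] := is_lfp_bisim_prio G i; exact: dconv_symmetrize.
Qed.

End Converse.

Section Posterior.
Context {R : realType} {G : game_structure R}.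
Implicit Types (d : state G -> state G -> R) (i : player) (s t : state G).

Definition post_gap i d s t (x y yo xo : move G -> R) : R :=
  sup [set expect_for i s x xo k - expect_for i t y yo k | k in Cval d].

Lemma H_postE i d s t : H_post i d s t =
  Num.max (obs_dist s t) (sup_inf (mixed i s) (mixed i t) (fun x y =>
    sup_inf (mixed (opponent i) t) (mixed (opponent i) s)
      (post_gap i d s t x y))).
Proof. by []. Qed.

Lemma obs_dist_le_H_post i d : dle (@obs_dist R G) (H_post i d).
Proof. by move=> s t; rewrite H_postE le_max lexx. Qed.

Lemma bnd1_expect_gap i d s t x y yo xo :
  mixed i s x -> mixed i t y ->
  mixed (opponent i) t yo -> mixed (opponent i) s xo ->
  bnd1 (Cval d) (fun k => expect_for i s x xo k - expect_for i t y yo k).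
Proof.
move=> mx my myo mxo k [vk _].
by have := expect_for_itv mx mxo vk; have := expect_for_itv my myo vk; lra.
Qed.

Section Bounds.
Variables (i : player) (d : state G -> state G -> R) (s t : state G).
Hypothesis dd : directed_metric d.

Let norm_post_gap_le1 x y yo xo : mixed i s x -> mixed i t y ->
  mixed (opponent i) t yo -> mixed (opponent i) s xo ->
  `|post_gap i d s t x y yo xo| <= 1.
Proof.
move=> mx my myo mxo; rewrite ler_norml.
exact: bnd1_sup (Cval_neq0 dd) (bnd1_expect_gap mx my myo mxo).
Qed.

Let norm_inner_le1 x y : mixed i s x -> mixed i t y ->
  `|sup_inf (mixed (opponent i) t) (mixed (opponent i) s)
      (post_gap i d s t x y)| <= 1.
Proof.
move=> mx my; apply: norm_sup_inf_le; [exact: mixed_neq0..|].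
by move=> yo xo; exact: norm_post_gap_le1.
Qed.

Lemma H_post_le c : obs_dist s t <= c ->
  (forall x, mixed i s x -> exists2 y, mixed i t y &
     forall yo, mixed (opponent i) t yo -> exists2 xo,
     mixed (opponent i) s xo & post_gap i d s t x y yo xo <= c) ->
  H_post i d s t <= c.
Proof.
move=> oc gap_le; rewrite H_postE ge_max oc /=.
apply: (sup_inf_le (mixed_neq0 _ _) (mixed_neq0 _ _) norm_inner_le1) => x mx.
have [y my {}gap_le] := gap_le x mx; exists y => //.
by apply: (sup_inf_le (mixed_neq0 _ _) (mixed_neq0 _ _)
  (fun yo xo => norm_post_gap_le1 mx my (yo := yo) (xo := xo))).
Qed.

Lemma le_H_post c x : mixed i s x ->
  (forall y, mixed i t y -> exists2 yo, mixed (opponent i) t yo &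
     forall xo, mixed (opponent i) s xo -> c <= post_gap i d s t x y yo xo) ->
  c <= H_post i d s t.
Proof.
move=> mx le_gap; rewrite H_postE le_max; apply/orP; right.
apply: (le_sup_inf (mixed_neq0 _ _) (mixed_neq0 _ _) norm_inner_le1 mx) => y my.
have [yo myo {}le_gap] := le_gap y my.
by apply: (le_sup_inf (mixed_neq0 _ _) (mixed_neq0 _ _)
  (fun yo xo => norm_post_gap_le1 mx my (yo := yo) (xo := xo)) myo).
Qed.

End Bounds.

Lemma Cval_interp d (v : obs G) : dle (@obs_dist R G) d -> Cval d (interp v).
Proof.
move=> od; split=> [u|u w]; first exact: interp_itv.
apply: le_trans (ler_norm _) (le_trans _ (od u w)).
exact: (le_bigmax _ (fun v : obs G => `|interp v u - interp v w|)).
Qed.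

Lemma obs_dist_le_sim_post i : dle (@obs_dist R G) (sim_post i).
Proof.
by have [_ <- _] := is_lfp_sim_post G i; exact: obs_dist_le_H_post.
Qed.

Lemma obs_dist_le_bisim_post i : dle (@obs_dist R G) (bisim_post i).
Proof.
have [_ <- _] := is_lfp_bisim_post G i => s t.
by rewrite le_max obs_dist_le_H_post.
Qed.

End Posterior.

Section CoinGame.
Context {R : realType}.

(* [inl false] is the fair coin, [inl true] the steered one, and [inr b] the
   outcome, heads if [b]; the transitions from outcomes are irrelevant. *)
Definition bias (s : bool + bool) (a1 a2 : R) : R :=
  if s is inl true then (a1 + 2 * a2) / 3 else 1 / 2.

Definition bias_for (i : player) (s : bool + bool) (a ao : R) : R :=
  match i with P1 => bias s a ao | P2 => bias s ao a end.

Definition coin_delta (s : bool + bool) (a1 a2 : bool) (u : bool + bool) : R :=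
  match u with
  | inl _ => 0
  | inr true => bias s a1%:R a2%:R
  | inr false => 1 - bias s a1%:R a2%:R
  end.

Definition is_heads (v : unit) (u : bool + bool) : R := (u == inr true)%:R.

Lemma is_heads_itv v u : 0 <= is_heads v u <= 1.
Proof. by rewrite ler0n lern1 leq_b1. Qed.

Lemma coin_delta_distr s a1 a2 : is_distr (coin_delta s a1 a2).
Proof.
split=> [u|]; last by rewrite big_sumType !big_bool /=; ring.
by case: s u a1 a2 => [[]|b] [u|[]] [] [] //=; lra.
Qed.

Lemma coin_moves_neq0 (i : player) (s : bool + bool) :
  [set: bool]%SET != finset.set0.
Proof. by apply/set0Pn; exists true. Qed.

Definition coin_game : game_structure R :=
  GameStructure is_heads_itv coin_moves_neq0 coin_delta_distr.

Definition fair_coin : state coin_game := inl false.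
Definition steered_coin : state coin_game := inl true.
Definition heads : state coin_game := inr true.
Definition tails : state coin_game := inr false.

Definition bernoulli (p : R) (b : bool) : R := if b then p else 1 - p.

Implicit Types (i : player) (s t : state coin_game) (p : R).
Implicit Types (d : state coin_game -> state coin_game -> R).

Lemma mixed_bernoulli i s p : 0 <= p <= 1 -> mixed i s (bernoulli p).
Proof.
move=> p01; split; last by move=> a; rewrite inE.
by split=> [[]|]; rewrite ?big_bool /=; lra.
Qed.

Lemma mixed_coin i s (x : move coin_game -> R) :
  mixed i s x -> 0 <= x true <= 1 /\ x false = 1 - x true.
Proof.
move=> [[x0]]; rewrite big_bool /= => x1 _.
by have := x0 true; have := x0 false; split; lra.
Qed.

Lemma expect_coin i s x xo k : mixed i s x -> mixed (opponent i) s xo ->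
  expect_for i s x xo k =
  k tails + bias_for i s (x true) (xo true) * (k heads - k tails).
Proof.
move=> /mixed_coin[_ xE] /mixed_coin[_ xoE].
case: i; rewrite /= /expect /delta_mixed big_sumType /= !big_bool /= xE xoE.
all: by rewrite /heads /tails; case: s => [[]|b] /=; field.
Qed.

Lemma post_gap_coin i d s t x y yo xo : dle (@obs_dist R coin_game) d ->
  mixed i s x -> mixed i t y ->
  mixed (opponent i) t yo -> mixed (opponent i) s xo ->
  post_gap i d s t x y yo xo =
  `|bias_for i s (x true) (xo true) - bias_for i t (y true) (yo true)|.
Proof.
move=> od mx my myo mxo; set ps := bias_for _ _ _ _; set pt := bias_for _ _ _ _.
have gapE k : expect_for i s x xo k - expect_for i t y yo k =
    (ps - pt) * (k heads - k tails).
  by rewrite !expect_coin // -/ps -/pt; ring.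
have Cheads : Cval d (is_heads tt) by exact: (@Cval_interp _ coin_game d tt od).
have Ctails : Cval d (fun u => 1 - is_heads tt u).
  apply: (@Cval_compl _ _ (dconv d)); apply: (@Cval_interp _ coin_game _ tt).
  by move=> u w; rewrite obs_distC; exact: od.
apply/le_anti/andP; split.
  apply: sup_img_le => [|k [vk _]]; first by exists (is_heads tt).
  rewrite gapE; apply: le_trans (ler_norm _) _; rewrite normrM ler_piMr //.
  by rewrite ler_norml; have := vk heads; have := vk tails; lra.
have gap_bounded := bnd1_expect_gap (d := d) mx my myo mxo.
have := img_le_sup gap_bounded Cheads.
have := img_le_sup gap_bounded Ctails.
rewrite !gapE /is_heads /= -/(post_gap i d s t x y yo xo) ler_norml; lra.
Qed.

Lemma obs_dist_coins (b c : bool) :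
  obs_dist (inl b : state coin_game) (inl c : state coin_game) = 0.
Proof.
apply/le_anti; rewrite obs_dist_ge0 andbT.
by apply: bigmax_le => // v _; rewrite /= /is_heads subrr normr0.
Qed.

Section HPostBounds.
Variable d : state coin_game -> state coin_game -> R.
Hypotheses (dd : directed_metric d) (od : dle (@obs_dist R coin_game) d).

Let half01 : 0 <= (1 / 2 : R) <= 1.
Proof. by lra. Qed.

Lemma H_post_P1_fair_steered_ge : 1 / 3 <= H_post P1 d fair_coin steered_coin.
Proof.
have zero01 : 0 <= (0 : R) <= 1 by lra.
have one01 : 0 <= (1 : R) <= 1 by lra.
apply: (le_H_post dd (mixed_bernoulli P1 fair_coin zero01)) => y my.
have [y01 _] := mixed_coin my.
have [yh|yh] := leP (1 / 2) (y true).
  exists (bernoulli 1) => [|xo mxo]; first exact: mixed_bernoulli.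
  rewrite post_gap_coin //; try exact: mixed_bernoulli.
  by rewrite /= ler_normr; apply/orP; right; lra.
exists (bernoulli 0) => [|xo mxo]; first exact: mixed_bernoulli.
rewrite post_gap_coin //; try exact: mixed_bernoulli.
by rewrite /= ler_normr; apply/orP; left; lra.
Qed.

Lemma H_post_P2_fair_steered_le : H_post P2 d fair_coin steered_coin <= 1 / 6.
Proof.
apply: H_post_le => // [|x mx]; first by rewrite obs_dist_coins; lra.
exists (bernoulli (1 / 2)) => [|yo myo]; first exact: mixed_bernoulli.
have [yo01 _] := mixed_coin myo.
exists (bernoulli (1 / 2)); first exact: mixed_bernoulli.
by rewrite post_gap_coin ?ler_norml /=; [lra|try exact: mixed_bernoulli..].
Qed.

Lemma H_post_P2_steered_fair_le : H_post P2 d steered_coin fair_coin <= 1 / 6.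
Proof.
apply: H_post_le => // [|x mx]; first by rewrite obs_dist_coins; lra.
have [x01 _] := mixed_coin mx.
exists (bernoulli (1 / 2)) => [|yo myo]; first exact: mixed_bernoulli.
have mxo : mixed P1 steered_coin (bernoulli (1 - x true)).
  by apply: mixed_bernoulli; lra.
exists (bernoulli (1 - x true)) => //.
by rewrite post_gap_coin ?ler_norml /=; [lra|try exact: mixed_bernoulli..].
Qed.

End HPostBounds.

Lemma sim_post_P1_fair_steered_ge :
  1 / 3 <= sim_post P1 fair_coin steered_coin.
Proof.
have [dd <- _] := is_lfp_sim_post coin_game P1.
exact: H_post_P1_fair_steered_ge dd (@obs_dist_le_sim_post _ _ _).
Qed.

Lemma sim_post_P2_steered_fair_le :
  sim_post P2 steered_coin fair_coin <= 1 / 6.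
Proof.
have [dd <- _] := is_lfp_sim_post coin_game P2.
exact: H_post_P2_steered_fair_le dd (@obs_dist_le_sim_post _ _ _).
Qed.

Lemma bisim_post_P1_fair_steered_ge :
  1 / 3 <= bisim_post P1 fair_coin steered_coin.
Proof.
have [dd <- _] := is_lfp_bisim_post coin_game P1.
rewrite le_max; apply/orP; left.
exact: H_post_P1_fair_steered_ge dd (@obs_dist_le_bisim_post _ _ _).
Qed.

Lemma bisim_post_P2_fair_steered_le :
  bisim_post P2 fair_coin steered_coin <= 1 / 6.
Proof.
have [dd <- _] := is_lfp_bisim_post coin_game P2.
have od : dle _ (bisim_post P2) := @obs_dist_le_bisim_post R coin_game P2.
rewrite ge_max; apply/andP; split.
  exact: H_post_P2_fair_steered_le dd od.
exact: H_post_P2_steered_fair_le dd od.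
Qed.

End CoinGame.

Theorem theorem3p8 (R : realType) :
  (forall G : game_structure R,
     (forall s t : state G, sim_prio P1 s t = sim_prio P2 t s) /\
     bisim_prio (G := G) P1 = bisim_prio (G := G) P2) /\
  (exists (G : game_structure R) (s t : state G),
     sim_post P1 s t <> sim_post P2 t s) /\
  (exists (G : game_structure R) (s t : state G),
     bisim_post P1 s t <> bisim_post P2 s t).
Proof.
split=> [G|]; last split.
- split=> [s t|]; first by rewrite (sim_prio_opponent P1).
  by rewrite (bisim_prio_opponent P1).
- exists coin_game, fair_coin, steered_coin; apply/eqP; rewrite gt_eqF //.
  apply: le_lt_trans sim_post_P2_steered_fair_le _.
  by apply: lt_le_trans sim_post_P1_fair_steered_ge; lra.
- exists coin_game, fair_coin, steered_coin; apply/eqP; rewrite gt_eqF //.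
  apply: le_lt_trans bisim_post_P2_fair_steered_le _.
  by apply: lt_le_trans bisim_post_P1_fair_steered_ge; lra.
Qed.
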